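(* Let $N$ be an abelian group of odd order and let $H$ be a DDP group of even order. Let $G$ be a group with a surjective homomorphism $\pi: G\to H$ such that $\ker(\pi)\cong N$ and $\ker(\pi)$ is contained in the center of $G$ (that is, $G$ is a central extension of $H$ by $N$). Then $G$ is a DDP group.
   Context: A finite group $G$ of order $n$ is a DDP group if there is a permutation $g_0,\ldots,g_{n-1}$ of the elements of $G$ (each element listed exactly once) such that $g_0=1_G$ and $g_i^{-1}g_{i+1}\neq g_j^{-1}g_{j+1}$ for all $0\le i<j<n-1$. *)

(* Defs.v *)
From mathcomp Require Export all_boot all_fingroup all_solvable.

Set Implicit Arguments.
Unset Strict Implicit.
Unset Printing Implicit Defensive.

Local Open Scope group_scope.

(* The default value 1 of nth is never used: G is nonempty, so index 0 is in
   range, and the last condition only involves indices below #|G|. *)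
Definition DDP_group (gT : finGroupType) (G : {group gT}) : Prop :=
  exists g : seq gT,
    [/\ perm_eq g (enum G),
        nth 1 g 0 = 1
      & forall i j : nat, (i < j)%N -> (j < #|G| - 1)%N ->
          (nth 1 g i)^-1 * nth 1 g i.+1 <> (nth 1 g j)^-1 * nth 1 g j.+1].

(* Main.v *)
Require Import Defs.
From mathcomp Require Import zify.

Set Implicit Arguments.
Unset Strict Implicit.
Unset Printing Implicit Defensive.

Local Open Scope group_scope.

(** Quotienting by cyclic subgroups of the kernel reduces to a kernel <[z]> of
    odd order n.  Choose a lift t : H -> G with t d^-1 = (t d)^-1, and let
    s 0 = 1, ..., s (m - 1) be the partial products of the lifted differences
    of the sequence of H.  The sequence of G runs through the s i forwards and
    backwards, alternately, n times in all, and attaches the central factor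
    (w j)^(+-1) to s i in the j-th pass, the sign being the parity of i.  Here
    w is the zigzag u, u z^-1, u z, u z^-2, u z^2, ...; as m is even, the
    difference between the j-th and the next pass is z^(j+1).  Within the
    passes, d and d^-1 have compatible lifts, so it suffices that the squares
    of the w j are distinct and that the set of the w j with j even is closed
    under inversion, which u^2 = z^-((n-1)/2) ensures. *)

(** * Sequences as functions on indices *)

Definition invg_if {gT : finGroupType} (b : bool) (x : gT) :=
  if b then x^-1 else x.

Lemma invg_if_inj (gT : finGroupType) (b : bool) :
  injective (@invg_if gT b).
Proof. by case: b => // x y /invg_inj. Qed.

Lemma groupV_if (gT : finGroupType) (G : {group gT}) b x :
  x \in G -> invg_if b x \in G.
Proof. by case: b => //=; rewrite groupV. Qed.

Lemma DDP_groupE (gT : finGroupType) (G : {group gT}) :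
  DDP_group G ->
  exists g : nat -> gT,
    [/\ g 0 = 1, forall i, (i < #|G|)%N -> g i \in G,
        {in gtn #|G| &, injective g}
      & {in gtn #|G|.-1 &, injective (fun i => (g i)^-1 * g i.+1)}].
Proof.
case=> g [gG g0 gd]; exists (nth 1 g).
have sg : size g = #|G| by rewrite (perm_size gG) cardE.
have ug : uniq g by rewrite (perm_uniq gG) enum_uniq.
split=> //.
- by move=> i ltiG; rewrite -mem_enum -(perm_mem gG) mem_nth ?sg.
- by move=> i j; rewrite !inE -sg => ? ? /eqP; rewrite nth_uniq // => /eqP.
- move=> i j; rewrite !inE -subn1 => lti ltj eqd.
  by case: (ltngtP i j) => // lt_ij; [case: (gd i j) | case: (gd j i)].
Qed.

(** Left translation by [(g 0)^-1] preserves all quotients and moves the start to 1; by counting, an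
    injective family of [#|G|] elements lists all of [G]. *)
Lemma DDP_groupI (gT : finGroupType) (G : {group gT}) (g : nat -> gT) :
    (forall i, (i < #|G|)%N -> g i \in G) ->
    {in gtn #|G| &, injective g} ->
    {in gtn #|G|.-1 &, injective (fun i => (g i)^-1 * g i.+1)} ->
  DDP_group G.
Proof.
move=> gG g_inj gd_inj; pose a := (g 0)^-1.
have Ga : a \in G by rewrite groupV gG ?cardG_gt0.
exists (mkseq (fun i => a * g i) #|G|).
have us : uniq (mkseq (fun i => a * g i) #|G|).
  by apply/mkseq_uniqP => i j lti ltj /mulgI; apply: g_inj.
split.
- apply: uniq_perm => //; first exact: enum_uniq.
  apply: (uniq_min_size us _ _).2 => [x /mapP[i]|].
    by rewrite mem_iota mem_enum => /gG Ggi ->; rewrite groupM.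
  by rewrite size_mkseq cardE.
- by rewrite nth_mkseq ?cardG_gt0 // mulVg.
- move=> i j ltij ltj; rewrite !nth_mkseq; try lia.
  rewrite !invMg -!mulgA !mulKg => /gd_inj; rewrite !inE; lia.
Qed.

(** * Lifts compatible with inversion *)

Section InverseClosedLift.

Variables (gT hT : finGroupType) (G : {group gT}) (f : {morphism G >-> hT}).
Hypotheses (cKG : 'ker f \subset 'Z(G)) (oddK : odd #|'ker f|).

(** For any section [y], the product [y d * y d^-1] lies in the central kernel; dividing [y d] by a
    square root of it makes the lifts of [d] and [d^-1] cancel. If [d] is an involution, [t d] is
    thus its own inverse. *)
Lemma ex_lift_inv : exists t : hT -> gT,
  {in f @* G, forall d, [/\ t d \in G, f (t d) = d & t d^-1 = (t d)^-1]}.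
Proof.
pose y d := repr (f @*^-1 [set d]).
have yP d : d \in f @* G -> y d \in G /\ f (y d) = d.
  case/morphimP=> x Gx _ ->.
  have /mem_repr : x \in f @*^-1 [set f x] by rewrite !inE Gx /=.
  by rewrite -/(y (f x)) !inE => /andP[-> /eqP].
pose c d := y d * y d^-1.
(* a square root of [c d], since [#|'ker f|] is odd *)
pose r d := c d ^+ (uphalf #|'ker f|).
have cP d : d \in f @* G -> c d \in 'ker f.
  move=> Hd; have [Gy fy] := yP d Hd.
  have [Gy' fy'] := yP d^-1 (groupVr Hd).
  by apply/kerP; rewrite ?groupM // morphM // fy fy' mulgV.
have rP d : d \in f @* G -> r d \in 'ker f by move=> Hd; rewrite groupX ?cP.
exists (fun d => y d * (r d)^-1) => d Hd.
have [Gy fy] := yP d Hd; have [Gy' fy'] := yP d^-1 (groupVr Hd).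
have Kr := rP d Hd; have Gr : r d \in G := dom_ker Kr.
have ZK x : x \in 'ker f -> {in G, forall v, commute x v}.
  by move=> /(subsetP cKG)/centerP[].
(* [c d^-1] is the conjugate of the central element [c d] by [y d]. *)
have cV : c d^-1 = c d.
  rewrite /c invgK; apply: (mulgI (y d)).
  by rewrite mulgA -/(c d) -(ZK _ (cP d Hd) _ Gy).
split; first by rewrite groupM ?groupV.
  by rewrite morphM ?groupV // morphV // (mker Kr) invg1 mulg1.
rewrite /r cV -/(r d) invMg invgK.
apply: (mulgI (y d)); rewrite mulgA -/(c d).
have -> : c d = r d * r d.
  rewrite -expgD addnn uphalf_half oddK add1n.
  rewrite doubleS -[_.*2.+1]add1n -[1%N]/(nat_of_bool true) -{1}oddK.
  by rewrite odd_double_half expgS expg_cardG ?cP ?mulg1.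
rewrite mulgK [RHS]mulgA -(ZK _ Kr) ?mulgK //.
Qed.

End InverseClosedLift.

(** * The zigzag in a cyclic group of odd order *)

Section Zigzag.

Variables (gT : finGroupType) (z : gT).
Hypothesis odd_z : odd #[z].

(** With [#[z] = 2k + 1], the exponent [k(k + 1)] is half of [k] modulo [#[z]]. *)
Definition zigzag_start := z ^- (#[z]./2 * #[z]./2.+1).

Definition zigzag j :=
  zigzag_start * (if odd j then z ^- j./2.+1 else z ^+ j./2).

Lemma zigzag_start_sqr : zigzag_start ^+ 2 * z ^+ #[z]./2 = 1.
Proof.
rewrite /zigzag_start expVgn -expgM.
apply: (mulgI (z ^+ (#[z]./2 * #[z]./2.+1 * 2))); rewrite mulKVg mulg1.
apply/eqP; rewrite eq_expg_mod_order.
have -> : (#[z]./2 * #[z]./2.+1 * 2 = #[z]./2 * #[z] + #[z]./2)%N.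
  have := odd_double_half #[z]; rewrite odd_z; nia.
by rewrite modnMDl.
Qed.

Lemma zigzag_in j : zigzag j \in <[z]>.
Proof.
rewrite groupM ?groupV ?mem_cycle //.
by case: ifP; rewrite ?groupV mem_cycle.
Qed.

Lemma expg_order_inj i j :
  (i < #[z])%N -> (j < #[z])%N -> z ^+ i = z ^+ j -> i = j.
Proof.
by move=> lti ltj /eqP; rewrite eq_expg_mod_order !modn_small // => /eqP.
Qed.

(** Write [u] for [zigzag_start] and [#[z] = 2k + 1]. The even-indexed terms are [u z^a] with
    [0 <= a <= k], and [u^2 = z^-k] gives [(u z^a)^-1 = u z^(k - a)], again of this form. The
    odd-indexed terms [u z^-c], with [1 <= c <= k], are the other elements of [<[z]>]. *)
Lemma zigzag_parity b i j : (i < #[z])%N -> (j < #[z])%N ->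
  odd i -> ~~ odd j -> zigzag i <> invg_if b (zigzag j).
Proof.
move=> lti ltj oi oj; have := odd_double_half #[z]; rewrite odd_z => oz.
have := odd_double_half i; have := odd_double_half j.
rewrite oi (negPf oj) /zigzag oi (negPf oj) => ej ei.
have cu x : x \in <[z]> -> commute zigzag_start x.
  move=> zx; apply: (centsP (cycle_abelian z)) => //.
  by rewrite groupV mem_cycle.
case: b => /= [|/mulgI /(congr1 (mulg (z ^+ i./2.+1)))]; last first.
  rewrite mulgV -expgD -(expg0 z) => /expg_order_inj; lia.
move=> eq_ij.
have eq1 : zigzag_start ^+ 2 * (z ^+ j./2 * z ^- i./2.+1) = 1.
  rewrite expgS expg1 -(mulgV (zigzag_start * z ^+ j./2)) -eq_ij -!mulgA.
  by congr (_ * _); rewrite !mulgA cu ?mem_cycle.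
move: (etrans eq1 (esym zigzag_start_sqr)) => /mulgI/(canRL (mulgKV _)).
rewrite -expgD => /expg_order_inj; lia.
Qed.

Lemma zigzag_inj : {in gtn #[z] &, injective zigzag}.
Proof.
move=> i j; rewrite !inE => lti ltj eq_ij.
have [oi|oi] := boolP (odd i); have [oj|oj] := boolP (odd j).
- move: eq_ij; rewrite /zigzag oi oj => /mulgI/invg_inj/expg_order_inj; lia.
- by case: (@zigzag_parity false i j).
- by case: (@zigzag_parity false j i).
- move: eq_ij; rewrite /zigzag (negPf oi) (negPf oj) => /mulgI/expg_order_inj; lia.
Qed.

(** The zigzag jumps by [z^-(j + 1)] for even [j] and by [z^(j + 1)] for odd [j]; the inversion at
    even [j] makes the signs agree. *)
Lemma zigzag_step j :
  (invg_if (~~ odd j) (zigzag j))^-1 * invg_if (~~ odd j) (zigzag j.+1) = z ^+ j.+1.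
Proof.
have cz x y : x \in <[z]> -> y \in <[z]> -> commute x y.
  by move=> zx zy; apply: (centsP (cycle_abelian z)).
have := odd_double_half j; have := odd_double_half j.+1; rewrite /= => ej1 ej.
case oj: (odd j) ej1 ej => /= ej1 ej.
  rewrite /zigzag /= oj /= invMg mulgA mulgKV invgK -expgD; congr (_ ^+ _); lia.
rewrite invgK cz ?groupV ?zigzag_in // /zigzag /= oj /= invMg mulgA mulgKV.
rewrite invgK -expgD; congr (_ ^+ _); lia.
Qed.

End Zigzag.

Lemma odd_order_sqr_inj (gT : finGroupType) (A : {group gT}) :
  odd #|A| -> {in A &, injective (fun x : gT => x ^+ 2)}.
Proof.
move=> oA; apply: (can_in_inj (g := fun x => x ^+ expg_invn A 2)) => x Ax.
by apply: expgK => //; rewrite coprimen2.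
Qed.

(** * Extensions with cyclic kernel *)

Section CyclicKernel.

Variables (gT hT : finGroupType) (G : {group gT}) (f : {morphism G >-> hT}).
Variable z : gT.
Hypotheses (kerfE : 'ker f = <[z]>) (cKG : 'ker f \subset 'Z(G)).
Hypotheses (odd_z : odd #[z]) (even_fG : ~~ odd #|f @* G|).

Let n := #[z].
Let m := #|f @* G|.

Variables (h : nat -> hT) (t : hT -> gT).
Hypotheses (h0 : h 0 = 1) (hG : forall i, (i < m)%N -> h i \in f @* G).
Hypothesis h_inj : {in gtn m &, injective h}.
Hypothesis dh_inj : {in gtn m.-1 &, injective (fun i => (h i)^-1 * h i.+1)}.
Hypothesis tP :
  {in f @* G, forall d, [/\ t d \in G, f (t d) = d & t d^-1 = (t d)^-1]}.

Let d i := (h i)^-1 * h i.+1.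
Fixpoint lift_seq i := if i is i'.+1 then lift_seq i' * t (d i') else 1.
Local Notation s := lift_seq.
Local Notation w := (zigzag z).

Definition ext_cell i j := s i * invg_if (odd i) (w j).

(* Term [l] lies in pass [l %/ m], over [h (ext_pos l)]; odd passes run
   backwards. *)
Definition ext_pos l := if odd (l %/ m) then (m.-1 - l %% m)%N else (l %% m)%N.

Definition ext_seq l := ext_cell (ext_pos l) (l %/ m).

Let m_gt0 : (0 < m)%N. Proof. exact: cardG_gt0. Qed.
Let odd_m1 : odd m.-1. Proof. by move: even_fG; rewrite -/m; lia. Qed.

Let dG i : (i.+1 < m)%N -> d i \in f @* G.
Proof. by move=> lti; rewrite groupM ?groupV ?hG // ltnW. Qed.

Let d_neq1 i : (i.+1 < m)%N -> d i <> 1.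
Proof.
move=> lti /(canRL (mulKVg _)); rewrite mulg1 => /h_inj; rewrite !inE; lia.
Qed.

Let card_G : #|G| = (m * n)%N.
Proof. by rewrite /m /n orderE -kerfE card_morphim setIid mulnC Lagrange ?subsetIl. Qed.

Let Kz x : x \in <[z]> -> x \in G /\ f x = 1.
Proof. by rewrite -kerfE => Kx; rewrite (dom_ker Kx) (mker Kx). Qed.

Let Zz x y : x \in <[z]> -> y \in G -> commute x y.
Proof. by rewrite -kerfE => /(subsetP cKG)/centerP[_]; apply. Qed.

Lemma lift_seqP i : (i < m)%N -> s i \in G /\ f (s i) = h i.
Proof.
elim: i => [|i IHi] lti; first by rewrite /= group1 morph1 h0.
have [Gs fs] := IHi (ltnW lti); have [Gt ft _] := tP (dG lti).
by rewrite /= groupM // morphM // fs ft mulKVg.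
Qed.

Lemma ext_cellP i j : (i < m)%N -> ext_cell i j \in G /\ f (ext_cell i j) = h i.
Proof.
move=> lti; have [Gs fs] := lift_seqP lti.
have [Gw fw] := Kz (groupV_if (odd i) (zigzag_in z j)).
by rewrite /ext_cell groupM // morphM // fs fw mulg1.
Qed.

Lemma ext_pos_lt l : (ext_pos l < m)%N.
Proof. by rewrite /ext_pos; have := ltn_pmod l m_gt0; case: ifP; lia. Qed.

Lemma ext_pos_inj l l' :
  l %/ m = l' %/ m -> ext_pos l = ext_pos l' -> l = l'.
Proof.
rewrite /ext_pos => eq_j; rewrite eq_j => eq_i.
suff eq_r : l %% m = l' %% m by rewrite (divn_eq l m) eq_j eq_r -divn_eq.
have := ltn_pmod l m_gt0; have := ltn_pmod l' m_gt0.
by move: eq_i; case: ifP => _; lia.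
Qed.

Let ltn_pass l : (l < #|G|)%N -> (l %/ m < n)%N.
Proof. by rewrite card_G ltn_divLR // mulnC. Qed.

(** The image under [f] recovers the position, and the remaining central factor recovers the
    pass. *)
Lemma ext_seq_inj : {in gtn #|G| &, injective ext_seq}.
Proof.
move=> l l'; rewrite !inE => ltl ltl' eq_l.
have [lti lti'] := (ext_pos_lt l, ext_pos_lt l').
have eq_i : ext_pos l = ext_pos l'.
  apply: h_inj; rewrite ?inE //.
  have [_ <-] := ext_cellP (l %/ m) lti; have [_ <-] := ext_cellP (l' %/ m) lti'.
  by congr (f _).
apply: ext_pos_inj => //; move: eq_l; rewrite /ext_seq /ext_cell -eq_i.
by move/mulgI/invg_if_inj/(zigzag_inj odd_z); apply; rewrite inE ltn_pass.
Qed.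

(** The position is repeated between two passes, so [s] cancels and only zigzag terms remain. *)
Lemma ext_seq_turn l : l %% m = m.-1 ->
  (ext_seq l)^-1 * ext_seq l.+1 = z ^+ (l %/ m).+1.
Proof.
move=> eq_r.
have eq_l : l.+1 = ((l %/ m).+1 * m)%N by rewrite {1}(divn_eq l m) eq_r; lia.
have eq_j : l.+1 %/ m = (l %/ m).+1 by rewrite eq_l mulnK.
have eq_i : ext_pos l.+1 = ext_pos l.
  by rewrite /ext_pos eq_j eq_l modnMl eq_r /=; case: (odd _) => /=; lia.
rewrite /ext_seq eq_j eq_i /ext_cell invMg -mulgA mulKg.
(* Even passes end at position [m.-1], which is odd since [m] is even; odd passes end at 0. *)
have -> : odd (ext_pos l) = ~~ odd (l %/ m).
  by rewrite /ext_pos eq_r; case: ifP => _; rewrite ?subnn ?odd_m1.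
exact: zigzag_step.
Qed.

(* Inside a pass, the step from term [l] lifts [d (ext_edge l)] or its
   inverse. *)
Definition ext_edge l :=
  if odd (l %/ m) then (m.-2 - l %% m)%N else (l %% m)%N.

Lemma ext_edge_lt l : (l %% m < m.-1)%N -> ((ext_edge l).+1 < m)%N.
Proof. by rewrite /ext_edge; case: ifP => _; lia. Qed.

Lemma ext_edge_pos l : (l %% m < m.-1)%N ->
  ext_pos l = (ext_edge l + odd (l %/ m))%N.
Proof. by rewrite /ext_edge /ext_pos; case: ifP => _; lia. Qed.

(** Neighbouring positions have opposite parity, so the two central factors combine to a square
    instead of cancelling. A backward step contributes [(t d)^-1], which is [t d^-1]. *)
Lemma ext_seq_step l : (l %% m < m.-1)%N ->
  (ext_seq l)^-1 * ext_seq l.+1 =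
    t (invg_if (odd (l %/ m)) (d (ext_edge l)))
    * invg_if (odd (ext_edge l) (+) ~~ odd (l %/ m)) (w (l %/ m)) ^+ 2.
Proof.
move=> ltr; pose j := l %/ m; pose i := ext_edge l.
have lti : (i.+1 < m)%N := ext_edge_lt ltr.
have eq_l : l.+1 = (j * m + (l %% m).+1)%N by rewrite {1}(divn_eq l m); lia.
have eq_j : l.+1 %/ m = j by rewrite eq_l divnMDl // divn_small ?addn0 //; lia.
have eq_r : l.+1 %% m = (l %% m).+1 by rewrite eq_l modnMDl modn_small //; lia.
have eq_p : ext_pos l.+1 = (i + ~~ odd j)%N.
  by rewrite /ext_pos eq_j eq_r /i /ext_edge -/j; case: ifP => _ /=; lia.
rewrite /ext_seq eq_j eq_p ext_edge_pos // -/i -/j.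
have [Gt ft tV] := tP (dG lti).
have zw b : invg_if b (w j) \in <[z]> by rewrite groupV_if ?zigzag_in.
have Gw b : invg_if b (w j) \in G by case: (Kz (zw b)).
have [Gs _] := lift_seqP (ltnW lti).
case: (odd j) => /=; rewrite ?addn0 ?addn1 /ext_cell /=.
  rewrite tV !invMg -!mulgA (mulgA (s i)^-1) mulVg mul1g.
  rewrite Zz ?groupV // -?mulgA; last by rewrite groupM ?groupV.
  by case: (odd i); rewrite /= ?invgK.
rewrite !invMg -!mulgA mulKg Zz ?groupV // -?mulgA; last by rewrite groupM.
by case: (odd i); rewrite /= ?invgK.
Qed.

Lemma ext_seq_step_val l : (l %% m < m.-1)%N ->
  f ((ext_seq l)^-1 * ext_seq l.+1) = invg_if (odd (l %/ m)) (d (ext_edge l)).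
Proof.
move=> ltr; rewrite ext_seq_step //.
have Gd := groupV_if (odd (l %/ m)) (dG (ext_edge_lt ltr)).
have [Gt ft _] := tP Gd.
set b := _ (+) _.
have [Gw fw] := Kz (groupX 2 (groupV_if b (zigzag_in z (l %/ m)))).
by rewrite morphM // ft fw mulg1.
Qed.

(** Projection to [f @* G] separates turns, whose image is 1, from steps, whose image is not. Turns
    differ in their power of [z]; steps with equal images are told apart by the central squares. *)
Lemma ext_seq_quo_inj :
  {in gtn #|G|.-1 &, injective (fun l => (ext_seq l)^-1 * ext_seq l.+1)}.
Proof.
(* The end of the last pass is the end of the whole sequence, so a turn leads into a pass with index
   below [n]. *)
have lt_turn l : (l < #|G|.-1)%N -> l %% m = m.-1 -> ((l %/ m).+1 < n)%N.
  rewrite card_G => ltl eq_r; have := divn_eq l m; rewrite eq_r => eq_l.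
  by rewrite -(ltn_pmul2r m_gt0); lia.
have turn_or_step l : l %% m = m.-1 \/ (l %% m < m.-1)%N.
  by have := ltn_pmod l m_gt0; lia.
have turn_neq_step l l' : l %% m = m.-1 -> (l' %% m < m.-1)%N ->
    (ext_seq l)^-1 * ext_seq l.+1 <> (ext_seq l')^-1 * ext_seq l'.+1.
  move=> eq_r ltr /(congr1 f); rewrite (ext_seq_step_val ltr) (ext_seq_turn eq_r).
  have [_ ->] := Kz (mem_cycle z (l %/ m).+1) => /esym.
  have := d_neq1 (ext_edge_lt ltr); case: (odd _) => //= d1 /eqP.
  by rewrite invg_eq1 => /eqP.
move=> l l'; rewrite !inE => ltl ltl' eq_q.
have [eq_r|ltr] := turn_or_step l; have [eq_r'|ltr'] := turn_or_step l'.
- have [lt1 lt2] := (lt_turn l ltl eq_r, lt_turn l' ltl' eq_r').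
  move: eq_q; rewrite !ext_seq_turn // => /(expg_order_inj lt1 lt2)[eq_j].
  by rewrite (divn_eq l m) (divn_eq l' m) eq_r eq_r' eq_j.
- by case: (turn_neq_step l l').
- by case: (turn_neq_step l' l).
have := congr1 f eq_q; rewrite (ext_seq_step_val ltr) (ext_seq_step_val ltr') => eq_d.
(* Equal images have the same lift under [t], so the squares agree, and hence so do their roots in
   [<[z]>]. *)
move: eq_q; rewrite (ext_seq_step ltr) (ext_seq_step ltr') eq_d => /mulgI.
move/(odd_order_sqr_inj odd_z); rewrite !groupV_if ?zigzag_in // => /(_ isT isT).
have [ltj ltj'] : (l %/ m < n)%N /\ (l' %/ m < n)%N.
  by split; apply: ltn_pass; lia.
have [eq_o|] := eqVneq (odd (l %/ m)) (odd (l' %/ m)).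
  move: eq_d; rewrite eq_o => /invg_if_inj/dh_inj eq_e.
  have {}eq_e : ext_edge l = ext_edge l'.
    have := ext_edge_lt ltr; have := ext_edge_lt ltr'.
    by move=> *; apply: eq_e; rewrite inE; lia.
  rewrite eq_e => /invg_if_inj/(zigzag_inj odd_z); rewrite !inE => eq_j.
  apply: ext_pos_inj; first exact: eq_j.
  by rewrite !ext_edge_pos // eq_e eq_o.
(* The combined sign can be put on either side; [zigzag_parity] wants it on the even-indexed
   term. *)
have invg_ifE b b' (x y : gT) : invg_if b x = invg_if b' y ->
  x = invg_if (b (+) b') y /\ y = invg_if (b (+) b') x.
  case: b; case: b' => /=; [move/invg_inj-> | move<- | move-> | move->] => //.
    by rewrite invgK.
  by rewrite invgK.
move=> neq_o /invg_ifE[eq1 eq2].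
have [oj|oj] := boolP (odd (l %/ m)).
  by apply: False_ind; apply: zigzag_parity eq1 => //; move: neq_o; rewrite oj.
by apply: False_ind; apply: zigzag_parity eq2 => //; move: neq_o oj; case: odd; case: odd.
Qed.

Lemma DDP_group_ext : DDP_group G.
Proof.
apply: DDP_groupI ext_seq_inj ext_seq_quo_inj => l _.
by have [] := ext_cellP (l %/ m) (ext_pos_lt l).
Qed.

End CyclicKernel.

(** * Reduction to cyclic kernels *)

Lemma DDP_group_cyclic_ker (gT hT : finGroupType) (G : {group gT})
    (f : {morphism G >-> hT}) :
    cyclic ('ker f) -> odd #|'ker f| -> 'ker f \subset 'Z(G) ->
    ~~ odd #|f @* G| -> DDP_group (f @* G) ->
  DDP_group G.
Proof.
case/cyclicP=> z kerfE oddK cKG evenH /DDP_groupE[h [h0 hG h_inj dh_inj]].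
have [t tP] := ex_lift_inv cKG oddK.
have odd_z : odd #[z] by rewrite orderE -kerfE.
exact: (DDP_group_ext kerfE cKG odd_z evenH h0 hG h_inj dh_inj tP).
Qed.

(** Induction on the order of the kernel, over all groups at once: for [x != 1] in the kernel, [f]
    factors through [G / <[x]>]. The induced map [ff] has a smaller kernel, and the quotient map [q]
    has a cyclic one. *)
Lemma DDP_group_central_ker (gT hT : finGroupType) (G : {group gT})
    (f : {morphism G >-> hT}) :
    odd #|'ker f| -> 'ker f \subset 'Z(G) ->
    ~~ odd #|f @* G| -> DDP_group (f @* G) ->
  DDP_group G.
Proof.
have [k] := ubnP #|'ker f|; elim: k => // k IHk in gT G f *.
rewrite ltnS => leK oddK cKG evenH DDPH.
have [K1|/trivgPn[x Kx ntx]] := eqVneq ('ker f) 1.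
  by apply: (@DDP_group_cyclic_ker _ _ _ f) => //; rewrite K1 cyclic1.
have cx : x \in 'Z(G) := subsetP cKG x Kx.
have nxG : G \subset 'N(<[x]>).
  by rewrite cents_norm // centsC cycle_subG; case/setIP: cx.
have sxK : <[x]> \subset 'ker f by rewrite cycle_subG.
pose q := restrm_morphism nxG (coset_morphism <[x]>).
have kerq : 'ker q = <[x]>.
  rewrite ker_restrm ker_coset; apply/setIidPr.
  by rewrite (subset_trans sxK) ?subsetIl.
have sKqKf : 'ker q \subset 'ker f by rewrite kerq.
pose ff := factm_morphism sKqKf (subxx G).
have ffE : ff @* (q @* G) = f @* G by rewrite morphim_factm.
have kerff : 'ker ff = q @* 'ker f by rewrite ker_factm.
have oddKx : odd #|<[x]>| := oddSg sxK oddK.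
have cardK : (#|'ker ff| * #|<[x]>|)%N = #|'ker f|.
  rewrite kerff card_morphim (setIidPr _) ?subsetIl // kerq -divgS //.
  by rewrite divnK // cardSg.
have DDPq : DDP_group (q @* G).
  apply: (IHk _ _ ff); rewrite ?ffE //.
  - apply: leq_trans leK; rewrite -cardK ltn_Pmulr ?cardG_gt0 //.
    by rewrite cardG_gt1 cycle_eq1.
  - by move: oddK; rewrite -cardK oddM => /andP[].
  - by rewrite kerff (subset_trans (morphimS q cKG)) ?morphim_center.
  - by rewrite (_ : (ff @* _)%G = (f @* G)%G) //; apply: val_inj.
apply: (@DDP_group_cyclic_ker _ _ _ q); rewrite ?kerq ?cycle_cyclic //.
  by rewrite (subset_trans sxK).
(* [q @* G] has even order because it maps onto [f @* G]. *)
by apply: contra evenH => odd_q; rewrite -ffE morphim_odd.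
Qed.

Theorem corollary8 (nT hT gT : finGroupType)
    (N : {group nT}) (H : {group hT}) (G : {group gT})
    (pi : {morphism G >-> hT}) :
  abelian N -> odd #|N| ->
  DDP_group H -> ~~ odd #|H| ->
  pi @* G = H -> 'ker pi \isog N -> 'ker pi \subset 'Z(G) ->
  DDP_group G.
Proof.
move=> _ oddN DDPH evenH piG isoN cKG.
have eqH : (pi @* G)%G = H by apply: val_inj.
apply: (@DDP_group_central_ker _ _ _ pi) => //.
- by rewrite (card_isog isoN).
- by rewrite piG.
- by rewrite eqH.
Qed.
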